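(* Let $P$ be a two-triangle $C^1$ macro-patch and let $p\ge2$. Assume that the degree-$(p-2)$ residual-moment matrix $\widetilde C_P$, formed with coefficients $(A_m,\eta_m)$ on the conforming space $S_p^1(P)$, has full row rank. Then $$\dim\ker\widetilde C_P=2p+1 .$$ The same conclusion is stable under sufficiently small coefficient-projection perturbations: there is $\varepsilon>0$ such that whenever $\widehat C_P$ is the residual-moment matrix formed (in the same bases) with other coefficients and $\|\widehat C_P-\widetilde C_P\|_2<\varepsilon$, then $\dim\ker\widehat C_P=2p+1$.
   Context: A two-triangle macro-patch $P=K\cup\widetilde K$ consists of two nondegenerate triangles with disjoint interiors sharing exactly one full common edge. $S_p^1(P)=\{s\in C^1(P):s|_{K'}\in\mathbb P_p(K')\text{ for each of the two triangles }K'\}$ (complex-valued polynomials), and $Y_{p-2}(P)=\mathbb P_{p-2}(K)\times\mathbb P_{p-2}(\widetilde K)$ is the broken polynomial space of degree $\le p-2$. Given coefficients $A_m$ (symmetric $2\times2$ matrix field) and $\eta_m$ (scalar), polynomial on each triangle, and $\kappa>0$, the residual-moment map $\widetilde{\mathcal R}_P:S_p^1(P)\to Y_{p-2}(P)^*$ is $$\langle\widetilde{\mathcal R}_P(v),\psi\rangle=\sum_{K'\subset P}\Big[(A_m\nabla v,\nabla\psi)_{K'}-\langle n_{K'}\cdot A_m\nabla v,\psi\rangle_{\partial K'}-\kappa^2(\eta_mv,\psi)_{K'}\Big],\qquad\psi\in Y_{p-2}(P),$$ with $n_{K'}$ the outward unit normal to $K'$. $\widetilde C_P$ is the matrix of this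 map with respect to a fixed basis of $S_p^1(P)$ and a fixed basis of $Y_{p-2}(P)$; full row rank means rank equal to $\dim Y_{p-2}(P)$. *)

(* Defs.v *)
From mathcomp Require Import all_boot all_order all_algebra.
From mathcomp Require Import all_classical all_reals all_analysis.
From mathcomp Require Import complex.
(* The notations of mpoly clash with those of MathComp-Analysis. *)
From mathcomp Require Import -(notations) mpoly.

Set Implicit Arguments.
Unset Strict Implicit.
Unset Printing Implicit Defensive.

Import Order.TTheory GRing.Theory Num.Theory.
Import numFieldNormedType.Exports.

Local Open Scope classical_set_scope.
Local Open Scope complex_scope.
Local Open Scope ring_scope.

(* A piecewise polynomial function on [K U K'] is represented by the pair of
   its polynomial pieces; on nondegenerate triangles the pieces are determined
   by the function. *)
Notation pieces R := (mpoly 2 R[i] * mpoly 2 R[i])%type.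

Section Patch.
Variable R : realType.

Definition cross (u v : R * R) : R := u.1 * v.2 - u.2 * v.1.

Definition enorm2 (u : R * R) : R := Num.sqrt (u.1 ^+ 2 + u.2 ^+ 2).

(* A triangle is given by its three vertices; its edge number [i] is the one
   opposite to vertex [i], and runs from vertex [i + 1] to vertex [i - 1],
   indices being taken modulo 3. *)
Definition triangle := 'I_3 -> R * R.

Definition tri_set (T : triangle) : set (R * R) :=
  [set x | exists w : 'I_3 -> R,
     [/\ forall i, 0 <= w i, \sum_i w i = 1 & x = \sum_i w i *: T i]].

Definition edge_vec (T : triangle) (i : 'I_3) : R * R :=
  T (ord_pred i) - T (ordS i).

Definition edge_pt (T : triangle) (i : 'I_3) (t : R) : R * R :=
  T (ordS i) + t *: edge_vec T i.

Definition edge_set (T : triangle) (i : 'I_3) : set (R * R) :=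
  edge_pt T i @` `[0, 1].

Definition orientation (T : triangle) : R :=
  cross (T (inord 1) - T ord0) (T (inord 2) - T ord0).

Definition nondegenerate (T : triangle) : Prop := orientation T != 0.

(* For a positively oriented triangle the interior lies to the left of every
   edge vector [t], so the outward normal is [t] rotated clockwise by a right
   angle; the sign accounts for the other orientation. *)
Definition normal (T : triangle) (i : 'I_3) : R * R :=
  (Num.sg (orientation T) / enorm2 (edge_vec T i)) *:
    ((edge_vec T i).2, - (edge_vec T i).1).

Definition macro_patch (K K' : triangle) : Prop :=
  [/\ nondegenerate K, nondegenerate K',
      (tri_set K)° `&` (tri_set K')° = set0 &
      exists i j, edge_set K i = edge_set K' j /\
                  tri_set K `&` tri_set K' = edge_set K i].

(* Total degree: [msize q] is one more than the degree of [q], and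
   [msize 0 = 0]. *)
Definition Pdeg (d : nat) : set (mpoly 2 R[i]) := [set q | (msize q <= d.+1)%N].

Definition peval (q : mpoly 2 R[i]) (x : R * R) : R[i] :=
  meval (fun k : 'I_2 => (if k == ord0 then x.1 else x.2)%:C) q.

(* C^1 on a closed set [P]: continuous on [P], differentiable in the interior,
   with first partial derivatives that extend continuously to [P]. *)
Definition C1_real (P : set (R * R)) (f : R * R -> R) : Prop :=
  [/\ {within P, continuous f},
      forall x, P° x -> differentiable f x &
      forall e : R * R, e = (1, 0) \/ e = (0, 1) ->
        exists g : R * R -> R,
          {within P, continuous g} /\ forall x, P° x -> 'D_e f x = g x].

Definition C1_complex (P : set (R * R)) (s : R * R -> R[i]) : Prop :=
  C1_real P (fun x => complex.Re (s x)) /\ C1_real P (fun x => complex.Im (s x)).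

Definition conforming_space (K K' : triangle) (p : nat) : set (pieces R) :=
  [set q | [/\ Pdeg p q.1, Pdeg p q.2 &
     exists s : R * R -> R[i],
       [/\ C1_complex (tri_set K `|` tri_set K') s,
           forall x, tri_set K x -> s x = peval q.1 x &
           forall x, tri_set K' x -> s x = peval q.2 x]]].

Definition broken_space (d : nat) : set (pieces R) :=
  [set q | Pdeg d q.1 /\ Pdeg d q.2].

Definition is_basis (S : set (pieces R)) (n : nat) (b : 'I_n -> pieces R) :
    Prop :=
  [/\ forall i, S (b i),
      forall x : 'I_n -> R[i], \sum_i x i *: b i = 0 -> forall i, x i = 0 &
      forall s, S s -> exists x : 'I_n -> R[i], s = \sum_i x i *: b i].

(* The L^2 pairings are sesquilinear, antilinear in the second argument. *)
Definition tri_inner (T : triangle) (f g : R * R -> R[i]) : R[i] :=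
  let mu := (@lebesgue_measure R \x @lebesgue_measure R)%E in
  (\int[mu]_(x in tri_set T) complex.Re (f x * (g x)^*)) +i*
  (\int[mu]_(x in tri_set T) complex.Im (f x * (g x)^*)).

(* [f] may depend on the edge, as the normal flux does; arc length is
   [|edge_vec T i| dt]. *)
Definition bnd_pairing (T : triangle) (f : 'I_3 -> R * R -> R[i])
    (g : R * R -> R[i]) : R[i] :=
  let mu := @lebesgue_measure R in
  \sum_(i < 3) (enorm2 (edge_vec T i))%:C *
    let h t := f i (edge_pt T i t) * (g (edge_pt T i t))^* in
    ((\int[mu]_(t in `[0, 1]) complex.Re (h t)) +i*
     (\int[mu]_(t in `[0, 1]) complex.Im (h t))).

Record coefficients := Coefficients {
  coefA : 'M[mpoly 2 R[i]]_2;
  coefA_sym : coefA^T = coefA;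
  coef_eta : mpoly 2 R[i] }.

Definition flux (c : coefficients) (v : mpoly 2 R[i]) (k : 'I_2) :
    mpoly 2 R[i] := \sum_(l < 2) coefA c k l * mderiv l v.

Definition normal_flux (T : triangle) (c : coefficients) (v : mpoly 2 R[i])
    (i : 'I_3) (x : R * R) : R[i] :=
  ((normal T i).1)%:C * peval (flux c v ord0) x +
  ((normal T i).2)%:C * peval (flux c v ord_max) x.

Definition tri_residual (kappa : R) (T : triangle) (c : coefficients)
    (v psi : mpoly 2 R[i]) : R[i] :=
  \sum_(k < 2) tri_inner T (peval (flux c v k)) (peval (mderiv k psi))
  - bnd_pairing T (normal_flux T c v) (peval psi)
  - (kappa ^+ 2)%:C * tri_inner T (peval (coef_eta c * v)) (peval psi).

Definition residual (kappa : R) (K K' : triangle)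
    (c : coefficients * coefficients) (v psi : pieces R) : R[i] :=
  tri_residual kappa K c.1 v.1 psi.1 + tri_residual kappa K' c.2 v.2 psi.2.

Definition residual_matrix (kappa : R) (K K' : triangle)
    (c : coefficients * coefficients) (n m : nat)
    (v : 'I_n -> pieces R) (psi : 'I_m -> pieces R) : 'M[R[i]]_(m, n) :=
  \matrix_(i < m, j < n) residual kappa K K' c (v j) (psi i).

Definition dimker (m n : nat) (C : 'M[R[i]]_(m, n)) : nat :=
  \dim (lker (linfun (mulmx C : 'cV[R[i]]_n -> 'cV[R[i]]_m))).

Definition vnorm2 (n : nat) (x : 'cV[R[i]]_n) : R :=
  Num.sqrt (\sum_i (complex.Re (x i 0) ^+ 2 + complex.Im (x i 0) ^+ 2)).

Definition mxnorm2 (m n : nat) (C : 'M[R[i]]_(m, n)) : R :=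
  sup [set vnorm2 (C *m x) | x in [set x : 'cV[R[i]]_n | vnorm2 x <= 1]].

End Patch.

(* Main.v *)
(* If the residual-moment matrix has full row rank, its kernel has dimension
   dim S - dim Y, and full row rank is an open condition.  So only
   dim S = C(p+2,2) + C(p,2) and dim Y = 2 C(p,2) matter.  For the former, a
   pair (q1, q2) glues to a C^1 function iff q2 - q1 and its gradient vanish on
   the common edge.  In affine coordinates (t, l), with t a coordinate along the
   edge and l = 0 on its line, this says that only monomials t^a l^b with
   b >= 2 occur in q2 - q1. *)

Require Import Defs.
From mathcomp Require Import all_boot all_order all_algebra.
From mathcomp Require Import all_classical all_reals all_analysis.
From mathcomp Require Import complex.
From mathcomp Require Import -(notations) mpoly.
From mathcomp Require Import zify ring lra.

Set Implicit Arguments.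
Unset Strict Implicit.
Unset Printing Implicit Defensive.

Import Order.TTheory GRing.Theory Num.Theory.
Import numFieldNormedType.Exports.

Local Open Scope classical_set_scope.
Local Open Scope complex_scope.
Local Open Scope ring_scope.

(** * Linear algebra *)

(** [C1_real] says nothing directly about derivatives on the common edge: it asks for
    differentiability in the interior of the union and for partial derivatives that extend
    continuously. Each direction of the gluing criterion therefore needs its own argument. From C^1
    to equal gradients, every point of a closed triangle is a limit of interior points, so the
    single continuous extension has two computable values on the edge. Conversely, relatively
    interior points of the edge may be interior to the union, and differentiability of the glued
    function has to be proved there. The rest is counting. Affine substitutions preserve the total
    degree, so both spaces have bases made of monomials, and the pair (q1, q2) is encoded as (q1,
    q1) + (0, q2 - q1), with q1 free and q2 - q1 equal to l^2 times a polynomial of degree at most p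
    - 2. Since polynomial pairs form an infinite-dimensional space, dimensions appear as
    cardinalities of bases. *)

(** The matrix of coordinates of the [b i] along the [b' j] has independent rows, since a vanishing
    combination of rows would be a relation among the [b i]. Its rank is then its number of rows,
    which cannot exceed its number of columns. *)
Lemma independent_leq_card (F : fieldType) (V : lmodType F) (I J : finType)
    (b : I -> V) (b' : J -> V) :
  (forall x : I -> F, \sum_i x i *: b i = 0 -> forall i, x i = 0) ->
  (forall i, exists x : J -> F, b i = \sum_j x j *: b' j) ->
  (#|I| <= #|J|)%N.
Proof.
move=> bfree bspan.
have [N bN] := choice bspan.
pose M : 'M[F]_(#|I|, #|J|) := \matrix_(i, j) N (enum_val i) (enum_val j).
suff /eqP <- : row_free M by exact: rank_leq_col.
apply: inj_row_free => u uM0; apply/rowP => k; rewrite mxE.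
suff /bfree/(_ (enum_val k)) : \sum_i u ord0 (enum_rank i) *: b i = 0.
  by rewrite enum_valK.
under eq_bigr => i _ do rewrite bN scaler_sumr.
rewrite exchange_big /=; apply: big1 => j _.
under eq_bigr => i _ do rewrite scalerA.
rewrite -scaler_suml.
have /rowP/(_ (enum_rank j)) := uM0; rewrite !mxE => s0.
rewrite (_ : \sum_i _ = 0) ?scale0r// -[RHS]s0.
rewrite (reindex enum_rank) /=; last by apply/onW_bij/enum_rank_bij.
by apply: eq_bigr => i _; rewrite mxE !enum_rankK.
Qed.

(** The second basis has an arbitrary finite index type, so that explicit bases can be indexed by
    sums of types of monomials. *)
Lemma is_basis_card (R : realType) (S : set (pieces R)) (n : nat)
    (b : 'I_n -> pieces R) (I : finType) (b' : I -> pieces R) :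
  is_basis S b -> (forall i, S (b' i)) ->
  (forall x : I -> R[i], \sum_i x i *: b' i = 0 -> forall i, x i = 0) ->
  (forall s, S s -> exists x : I -> R[i], s = \sum_i x i *: b' i) ->
  n = #|I|.
Proof.
move=> [Sb bfree bspan] Sb' b'free b'span; apply/eqP.
rewrite -[n in n == _]card_ord eqn_leq.
rewrite (independent_leq_card bfree (fun i => b'span _ (Sb i))).
by rewrite (independent_leq_card b'free (fun i => bspan _ (Sb' i))).
Qed.

(** A right inverse of [C] makes the map onto; rank-nullity concludes. *)
Lemma dimker_full_rank (R : realType) (m n : nat) (C : 'M[R[i]]_(m, n)) :
  \rank C = m -> dimker C = (n - m)%N.
Proof.
move=> rC; rewrite /dimker.
have /row_freeP[D CD] : row_free C by rewrite /row_free rC.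
set f := linfun _.
have fE x : f x = C *m x by rewrite lfunE.
have := limg_ker_dim f fullv; rewrite capfv.
suff -> : (f @: fullv)%VS = fullv.
  have dimcV k : \dim {:'cV[R[i]]_k} = k by rewrite dimvf /dim /= muln1.
  by rewrite !dimcV => /(canRL (addnK _)).
apply/vspaceP => y; rewrite memvf.
by apply/memv_imgP; exists (D *m y); rewrite ?memvf// fE mulmxA CD mul1mx.
Qed.

(** * Euclidean norms and the stability of full row rank *)

Lemma vnorm2_ge0 (R : realType) (n : nat) (x : 'cV[R[i]]_n) : 0 <= vnorm2 x.
Proof. exact: sqrtr_ge0. Qed.

Lemma vnorm2_sq (R : realType) (n : nat) (x : 'cV[R[i]]_n) :
  vnorm2 x ^+ 2 =
  \sum_i (complex.Re (x i 0) ^+ 2 + complex.Im (x i 0) ^+ 2).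
Proof.
by rewrite sqr_sqrtr// sumr_ge0// => i _; rewrite addr_ge0 ?sqr_ge0.
Qed.

Lemma vnorm2_eq0 (R : realType) (n : nat) (x : 'cV[R[i]]_n) :
  vnorm2 x = 0 -> x = 0.
Proof.
move=> x0; apply/colP => i; rewrite mxE.
have : \sum_i (complex.Re (x i 0) ^+ 2 + complex.Im (x i 0) ^+ 2) == 0.
  by rewrite -vnorm2_sq x0 expr0n.
rewrite psumr_eq0 => [/allP/(_ i)|j _]; last by rewrite addr_ge0 ?sqr_ge0.
rewrite mem_index_enum => /(_ isT)/=.
rewrite paddr_eq0 ?sqr_ge0// !sqrf_eq0 => /andP[/eqP re0 /eqP im0].
by case: (x i 0) re0 im0 => a b /= -> ->.
Qed.

Lemma vnorm2N (R : realType) (n : nat) (x : 'cV[R[i]]_n) :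
  vnorm2 (- x) = vnorm2 x.
Proof.
congr Num.sqrt; apply: eq_bigr => i _; rewrite mxE.
by case: (x i 0) => a b /=; ring.
Qed.

Lemma vnorm2Z (R : realType) (n : nat) (a : R) (x : 'cV[R[i]]_n) :
  0 <= a -> vnorm2 (a%:C *: x) = a * vnorm2 x.
Proof.
move=> a0; apply/eqP; rewrite -(@eqrXn2 _ 2) ?mulr_ge0 ?vnorm2_ge0//.
rewrite exprMn !vnorm2_sq mulr_sumr; apply/eqP/eq_bigr => i _; rewrite mxE.
by case: (x i 0) => b d /=; ring.
Qed.

Lemma vnorm2_0 (R : realType) (n : nat) : vnorm2 (0 : 'cV[R[i]]_n) = 0.
Proof. by rewrite -(scale0r 0) vnorm2Z// mul0r. Qed.

(* The supremum of an unbounded set is the junk value 0, hence the need for an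
   explicit bound; this one is far from sharp. *)
Lemma vnorm2_mul_bound (R : realType) (m n : nat) (C : 'M[R[i]]_(m, n)) :
  exists2 B : R, 0 <= B & forall x, vnorm2 (C *m x) <= B * vnorm2 x.
Proof.
pose N (z : R[i]) : R := complex.Re z ^+ 2 + complex.Im z ^+ 2.
have N0 z : 0 <= N z by rewrite addr_ge0 ?sqr_ge0.
have NM z w : N (z * w) = N z * N w.
  by case: z => a b; case: w => a' b'; rewrite /N /=; ring.
(* Iterating [N (z + w) <= 2 * N z + 2 * N w] costs at most a factor 2 per term. The gap in that
   inequality is [N (z - w)], by the parallelogram identity. *)
have NS k (f : 'I_k -> R[i]) : N (\sum_i f i) <= 2 ^+ k * \sum_i N (f i).
  elim: k f => [|k IH] f.
    by rewrite !big_ord0 /N /= expr0n mulr0 addr0.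
  rewrite !big_ord_recl /=; set z := f ord0; set w := \sum_(i < k) _.
  have ND : N (z + w) <= 2 * N z + 2 * N w.
    rewrite -subr_ge0; move: z w => [a b] [a' b'].
    rewrite (_ : _ - _ = (a - a') ^+ 2 + (b - b') ^+ 2); last first.
      by rewrite /N /=; ring.
    by rewrite addr_ge0 ?sqr_ge0.
  have := IH (fun i => f (lift ord0 i)); rewrite -/w.
  set s := \sum_(i < k) _ => IHw.
  have P1 : 1 <= 2 ^+ k :> R by rewrite exprn_ege1// ler1n.
  rewrite exprS; apply: (le_trans ND); move: (N0 z) IHw P1.
  by move: (N z) (N w) s (2 ^+ k) => a b d P; nra.
pose B2 := \sum_i (2 ^+ n * \sum_j N (C i j)).
have B20 : 0 <= B2.
  by rewrite sumr_ge0// => i _; rewrite mulr_ge0 ?exprn_ge0// sumr_ge0.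
exists (Num.sqrt B2); first exact: sqrtr_ge0.
move=> x; rewrite -(@ler_pXn2r _ 2) ?nnegrE ?mulr_ge0 ?vnorm2_ge0 ?sqrtr_ge0//.
rewrite exprMn !vnorm2_sq sqr_sqrtr// mulr_suml.
apply: ler_sum => i _; rewrite mxE.
have NxS j : N (x j 0) <= \sum_i N (x i 0).
  by rewrite (bigD1 j)//= lerDl sumr_ge0.
apply: le_trans (NS _ _) _; rewrite -mulrA ler_pM2l ?exprn_gt0// mulr_suml.
by apply: ler_sum => j _; rewrite NM ler_wpM2l.
Qed.

Lemma vnorm2_mul_le_mxnorm2 (R : realType) (m n : nat) (C : 'M[R[i]]_(m, n)) x :
  vnorm2 x <= 1 -> vnorm2 (C *m x) <= mxnorm2 C.
Proof.
move=> x1; have [B B0 CB] := vnorm2_mul_bound C.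
apply: ub_le_sup; last by exists x.
exists B => _ [y /= y1 <-].
by rewrite (le_trans (CB y))// ler_piMr.
Qed.

Lemma vnorm2_mul_le (R : realType) (m n : nat) (C : 'M[R[i]]_(m, n)) x :
  vnorm2 (C *m x) <= mxnorm2 C * vnorm2 x.
Proof.
have [/vnorm2_eq0 ->|x0] := eqVneq (vnorm2 x) 0.
  by rewrite mulmx0 !vnorm2_0 mulr0.
have x_gt0 : 0 < vnorm2 x by rewrite lt0r x0 vnorm2_ge0.
have a0 : 0 <= (vnorm2 x)^-1 by rewrite invr_ge0 ltW.
rewrite -ler_pdivrMr// mulrC -vnorm2Z// scalemxAr.
by rewrite vnorm2_mul_le_mxnorm2// vnorm2Z// mulVf.
Qed.

Lemma mxnorm2_ge0 (R : realType) (m n : nat) (C : 'M[R[i]]_(m, n)) :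
  0 <= mxnorm2 C.
Proof.
apply: le_trans (vnorm2_ge0 (C *m 0)) _.
by apply: vnorm2_mul_le_mxnorm2; rewrite vnorm2_0.
Qed.

(** With [D] a right inverse of [C], the product [C' *m D] is a small perturbation of the identity,
    hence invertible, and [D *m invmx (C' *m D)] is a right inverse of [C']. *)
Lemma full_rank_stable (R : realType) (m n : nat) (C : 'M[R[i]]_(m, n)) :
  \rank C = m ->
  exists2 eps : R, 0 < eps &
    forall C' : 'M[R[i]]_(m, n), mxnorm2 (C' - C) < eps -> \rank C' = m.
Proof.
move=> rC.
have /row_freeP[D CD] : row_free C by rewrite /row_free rC.
have [B B0 DB] := vnorm2_mul_bound D.
(* Adding 1 keeps the radius well defined when [B] is 0. *)
exists (B + 1)^-1; first by rewrite invr_gt0 ltr_wpDl.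
move=> C' C'C; apply/eqP; rewrite -[_ == m]/(row_free C').
apply/row_freeP; exists (D *m invmx (C' *m D)).
rewrite mulmxA mulmxV// -unitmx_tr -row_free_unit.
apply: inj_row_free => u uC'D0; apply: trmx_inj; rewrite trmx0.
set x := u^T; apply: vnorm2_eq0.
(* A vector killed by [C' *m D] satisfies this identity because [C *m D] is 1; the norm bounds then
   give [vnorm2 x <= e * B * vnorm2 x] with [e * B < 1], which forces [x] to vanish. *)
have Ex : - x = (C' - C) *m (D *m x).
  rewrite mulmxBl !mulmxA CD mul1mx.
  by rewrite -[_ *m x]trmxK trmx_mul trmxK uC'D0 trmx0 sub0r.
have lex : vnorm2 x <= mxnorm2 (C' - C) * (B * vnorm2 x).
  rewrite -[leLHS]vnorm2N Ex; apply: le_trans (vnorm2_mul_le _ _) _.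
  by rewrite ler_wpM2l ?mxnorm2_ge0.
have B1 : 0 < B + 1 by rewrite ltr_wpDl.
have eB : mxnorm2 (C' - C) * (B + 1) < 1 by rewrite -ltr_pdivlMr// div1r.
apply/eqP; rewrite eq_le vnorm2_ge0 andbT.
move: lex eB (mxnorm2_ge0 (C' - C)) (vnorm2_ge0 x).
by move: (mxnorm2 _) (vnorm2 x) => e y; nra.
Qed.

(** * Differential calculus of polynomials and gluing *)

(** A squeeze: [h] is o(|y - x|) near [x], hence so is [u]. *)
Lemma is_diff0_le (R : numFieldType) (V W : normedModType R) (u h : V -> W)
    (x : V) :
  (\forall y \near x, `|u y| <= `|h y|) -> h x = 0 -> is_diff x h 0 ->
  is_diff x u 0.
Proof.
move=> uh hx0 [dh dh0].
have ux0 : u x = 0.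
  by apply/normr0_eq0/le_anti; rewrite normr_ge0 andbT -(normr0 W) -hx0;
    exact: (nbhs_singleton uh).
have := diff_locally dh; rewrite hx0 dh0 => /eqaddoP ho.
have uo (e : R) : 0 < e ->
    \forall y \near (0 : V), `|(u \o shift x) y| <= e * `|y|.
  move=> e0; have := ho e e0.
  move: uh; rewrite (near_shift 0) subr0.
  apply: filterS2 => y /= uhy; apply: le_trans.
  by rewrite fctE /= /cst addr0 subr0.
have E : u \o shift x = cst (u x) + (\0 : V -> W) +o_ 0 id.
  by rewrite ux0; apply/eqaddoP; rewrite addr0 subr0.
have du : 'd u x = \0 :> (V -> W).
  by apply: diff_unique => //; exact: cst_continuous.
apply: DiffDef => //; apply/diff_locallyP; rewrite du; split => //.
exact: cst_continuous.
Qed.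

Lemma mderivXU (n : nat) (A : comNzRingType) (i j : 'I_n) :
  mderiv j (mpolyX A (mnm1 i)) = (i == j)%:R.
Proof.
rewrite mderivX mnm1E; case: eqP => [->|_]; last by rewrite scale0r.
rewrite (_ : mnm_sub _ _ = mnm0) ?mpolyX0 ?scale1r//.
by apply/mnmP => k; rewrite mnmBE mnm0E subnn.
Qed.

(** Constants and variables generate the ring. The chain rule and the identities about substitution
    are compatible with sums and products, so this induction proves them without handling
    exponents. *)
Lemma mpoly_ring_ind (n : nat) (A : comNzRingType) (P : mpoly n A -> Prop) :
  (forall a, P (mpolyC n a)) -> (forall k, P (mpolyX A (mnm1 k))) ->
  (forall p q, P p -> P q -> P (p + q)) ->
  (forall p q, P p -> P q -> P (p * q)) -> forall q, P q.
Proof.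
move=> PC PX PD PM; elim/mpolyind => [|a m q _ _ Pq].
  by rewrite -mpolyC0; exact: PC.
apply: (PD) => //; rewrite -mul_mpolyC mpolyXE_id; apply: (PM) => //.
apply: (big_ind P) => [|p1 p2 | k _]; [by rewrite -mpolyC1 | exact: PM |].
elim: (m k) => [|j IH]; first by rewrite expr0 -mpolyC1.
by rewrite exprS; exact: PM.
Qed.

Lemma pevalD (R : realType) (a b : mpoly 2 R[i]) (x : R * R) :
  peval (a + b) x = peval a x + peval b x.
Proof. exact: mevalD. Qed.

Lemma pevalB (R : realType) (a b : mpoly 2 R[i]) (x : R * R) :
  peval (a - b) x = peval a x - peval b x.
Proof. exact: mevalB. Qed.

Lemma pevalM (R : realType) (a b : mpoly 2 R[i]) (x : R * R) :
  peval (a * b) x = peval a x * peval b x.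
Proof. exact: mevalM. Qed.

Lemma ReM (R : realType) (z w : R[i]) :
  complex.Re (z * w) =
  complex.Re z * complex.Re w - complex.Im z * complex.Im w.
Proof. by case: z w => [? ?] [? ?]. Qed.

Lemma ImM (R : realType) (z w : R[i]) :
  complex.Im (z * w) =
  complex.Re z * complex.Im w + complex.Im z * complex.Re w.
Proof. by case: z w => [? ?] [? ?]. Qed.

(** Real and imaginary parts are treated together because the product rule mixes them. *)
Lemma is_diff_peval (R : realType) (q : mpoly 2 R[i]) (x : R * R) :
  let dq (e : R * R) := e.1%:C * peval (mderiv ord0 q) x +
                        e.2%:C * peval (mderiv ord_max q) x in
  is_diff x (fun y => complex.Re (peval q y)) (fun e => complex.Re (dq e)) /\
  is_diff x (fun y => complex.Im (peval q y)) (fun e => complex.Im (dq e)).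
Proof.
pose D (q : mpoly 2 R[i]) (e : R * R) :=
  e.1%:C * peval (mderiv ord0 q) x + e.2%:C * peval (mderiv ord_max q) x.
pose P (q : mpoly 2 R[i]) :=
  is_diff x (fun y => complex.Re (peval q y)) (fun e => complex.Re (D q e)) /\
  is_diff x (fun y => complex.Im (peval q y)) (fun e => complex.Im (D q e)).
rewrite -/(D q) -/(P q).
have PC a : P (mpolyC 2 a).
  have D0 : D (mpolyC 2 a) = fun=> 0.
    by apply/funext => e; rewrite /D !mderivC /peval !meval0 !mulr0 addr0.
  rewrite /P D0 /peval; under eq_fun do rewrite mevalC.
  under [X in _ /\ is_diff _ X _]eq_fun do rewrite mevalC.
  by split; exact: is_diff_cst.
have PD a b : P a -> P b -> P (a + b).
  have DD : D (a + b) = fun e => D a e + D b e.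
    have E k : peval (mderiv k (a + b)) x =
        peval (mderiv k a) x + peval (mderiv k b) x.
      by rewrite mderivD pevalD.
    apply/funext => e; rewrite /D 2!E; move: (e.1%:C) (e.2%:C) => u v.
    move: (peval _ x) (peval _ x) (peval _ x) (peval _ x) => z0 z1 y0 y1.
    by ring.
  move=> [a1 a2] [b1 b2]; rewrite /P DD.
  under eq_fun do rewrite pevalD raddfD.
  under [X in is_diff _ _ X]eq_fun do rewrite raddfD.
  under [X in _ /\ is_diff _ X _]eq_fun do rewrite pevalD raddfD.
  under [X in _ /\ is_diff _ _ X]eq_fun do rewrite raddfD.
  by split; [exact: (is_diffD a1 b1) | exact: (is_diffD a2 b2)].
have PM a b : P a -> P b -> P (a * b).
  have DM e : D (a * b) e = D a e * peval b x + peval a x * D b e.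
    have E k : peval (mderiv k (a * b)) x =
        peval (mderiv k a) x * peval b x + peval a x * peval (mderiv k b) x.
      by rewrite mderivM pevalD 2!pevalM.
    rewrite /D 2!E; move: (e.1%:C) (e.2%:C) (peval a x) (peval b x).
    move: (peval _ x) (peval _ x) (peval _ x) (peval _ x).
    move=> z0 z1 y0 y1 u v y z.
    by ring.
  move=> [a1 a2] [b1 b2]; split.
    rewrite (_ : (fun y => _) =
        (fun y => complex.Re (peval a y)) * (fun y => complex.Re (peval b y)) -
        (fun y => complex.Im (peval a y)) * (fun y => complex.Im (peval b y)));
      last first.
      by apply/funext => y; rewrite pevalM ReM.
    apply: is_diff_eq (is_diffB (is_diffM a1 b1) (is_diffM a2 b2)) _.
    apply/funext => e; rewrite DM.
    rewrite -[LHS]/(complex.Re (peval a x) * complex.Re (D b e) +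
      complex.Re (peval b x) * complex.Re (D a e) -
      (complex.Im (peval a x) * complex.Im (D b e) +
      complex.Im (peval b x) * complex.Im (D a e))).
    move: (peval a x) (peval b x) (D a e) (D b e) => [? ?] [? ?] [? ?] [? ?] /=.
    by ring.
  rewrite (_ : (fun y => _) =
      (fun y => complex.Re (peval a y)) * (fun y => complex.Im (peval b y)) +
      (fun y => complex.Im (peval a y)) * (fun y => complex.Re (peval b y)));
    last first.
    by apply/funext => y; rewrite pevalM ImM.
  apply: is_diff_eq (is_diffD (is_diffM a1 b2) (is_diffM a2 b1)) _.
  apply/funext => e; rewrite DM.
  rewrite -[LHS]/(complex.Re (peval a x) * complex.Im (D b e) +
    complex.Im (peval b x) * complex.Re (D a e) +
    (complex.Im (peval a x) * complex.Re (D b e) +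
    complex.Re (peval b x) * complex.Im (D a e))).
  move: (peval a x) (peval b x) (D a e) (D b e) => [? ?] [? ?] [? ?] [? ?] /=.
  by ring.
have PX k : P (mpolyX R[i] (mnm1 k)).
  have dk : is_diff x (fun y : R * R => if k == ord0 then y.1 else y.2)
                      (fun y : R * R => if k == ord0 then y.1 else y.2).
    case: eqP => _.
      have c1 : continuous (fst : R * R -> R) by move=> z; exact: cvg_fst.
      apply: DiffDef; first exact: (@linear_differentiable _ _ _ fst).
      exact: (@diff_lin _ _ _ fst).
    have c2 : continuous (snd : R * R -> R) by move=> z; exact: cvg_snd.
    apply: DiffDef; first exact: (@linear_differentiable _ _ _ snd).
    exact: (@diff_lin _ _ _ snd).
  rewrite /P /D /peval !mderivXU; under eq_fun do rewrite mevalXU.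
  under [X in _ /\ is_diff _ X _]eq_fun do rewrite mevalXU.
  have E (e : R * R) :
      e.1%:C * (k == ord0)%:R + e.2%:C * (k == ord_max)%:R =
      (if k == ord0 then e.1 else e.2)%:C.
    case: k {dk} => [[|[|//]] lk] /=; first by rewrite mulr1 mulr0 addr0.
    by rewrite mulr1 mulr0 add0r.
  split.
    apply: is_diff_eq dk _; apply/funext => e.
    by rewrite -!mpolyC_nat !mevalC E.
  apply: is_diff_eq (is_diff_cst 0 _) _; apply/funext => e.
  by rewrite -!mpolyC_nat !mevalC E.
exact: (mpoly_ring_ind PC PX PD PM).
Qed.

(* Near a point of [A `&` B] the glued function differs from [f] by a function
   dominated by [g - f], whose differential vanishes there. *)
Lemma is_diff_glue (R : numFieldType) (V W : normedModType R) (A B : set V)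
    (f g s df dg : V -> W) (x : V) :
  closed A -> closed B ->
  (forall y, A y -> s y = f y) -> (forall y, B y -> s y = g y) ->
  is_diff x f df -> is_diff x g dg -> (A x -> B x -> df = dg) ->
  (A `|` B)° x -> (A x -> is_diff x s df) /\ (B x -> is_diff x s dg).
Proof.
wlog suff main : A B f g df dg / closed A -> closed B ->
  (forall y, A y -> s y = f y) -> (forall y, B y -> s y = g y) ->
  is_diff x f df -> is_diff x g dg -> (A x -> B x -> df = dg) ->
  (A `|` B)° x -> A x -> is_diff x s df.
  move=> cA cB sf sg fd gd fg ABx; split; first exact: (main A B f g df dg).
  apply: (main B A g f dg df) => // [Bx Ax|]; first by rewrite fg.
  by rewrite setUC.
move=> cA cB sf sg fd gd fg ABx Ax.
have key (h : V -> W) : h x = 0 -> is_diff x h 0 ->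
    (\forall y \near x, `|s y - f y| <= `|h y|) -> is_diff x s df.
  move=> hx0 hd sfh.
  have sfd := is_diff0_le sfh hx0 hd.
  have -> : s = f + (fun y => s y - f y).
    by apply/funext => y; rewrite fctE addrC subrK.
  by apply: is_diff_eq (is_diffD fd sfd) _; rewrite addr0.
(* On the overlap, [g - f] dominates [s - f] and has zero differential. Off the closed set [B], [s]
   equals [f] near [x] and the zero function dominates. *)
have [Bx|nBx] := pselect (B x).
  apply: (key (g - f)).
  - by rewrite -[LHS]/(g x - f x) -sf// -sg// subrr.
  - by apply: is_diff_eq (is_diffB gd fd) _; rewrite fg// subrr.
  apply: filterS ABx => y [/sf ->|/sg ->]; last exact: lexx.
  by rewrite subrr normr0.
apply: (key (cst 0)) => //.
have : nbhs x (~` B) by apply: open_nbhs_nbhs; split => //; exact: closed_openC.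
apply: filterS2 ABx => y [/sf ->|//].
by rewrite subrr normr0.
Qed.

Lemma C1_real_glue (R : realType) (A B : set (R * R)) (f g s : R * R -> R)
    (df dg : R * R -> R * R -> R) :
  closed A -> closed B ->
  (forall x, A x -> s x = f x) -> (forall x, B x -> s x = g x) ->
  (forall x, is_diff x f (df x)) -> (forall x, is_diff x g (dg x)) ->
  (forall e, continuous (df ^~ e)) -> (forall e, continuous (dg ^~ e)) ->
  (forall x, A x -> B x -> df x = dg x) -> C1_real (A `|` B) s.
Proof.
move=> cA cB sf sg fd gd cdf cdg fg.
have glue (u v w : R * R -> R) : (forall x, A x -> w x = u x) ->
    (forall x, B x -> w x = v x) -> continuous u -> continuous v ->
    {within A `|` B, continuous w}.
  move=> wu wv cu cv; apply: withinU_continuous => //.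
    apply: (@subspace_eq_continuous _ _ _ u).
      by move=> x /set_mem Ax; exact/esym/wu.
    exact: continuous_subspaceT.
  apply: (@subspace_eq_continuous _ _ _ v).
    by move=> x /set_mem Bx; exact/esym/wv.
  exact: continuous_subspaceT.
have sd x : (A `|` B)° x ->
    (A x -> is_diff x s (df x)) /\ (B x -> is_diff x s (dg x)).
  by move=> ABx; apply: (is_diff_glue cA cB sf sg (fd x) (gd x) (fg x) ABx).
split.
- apply: (glue f g) => //.
    by move=> x; apply: differentiable_continuous; case: (fd x).
  by move=> x; apply: differentiable_continuous; case: (gd x).
- move=> x ABx; have [sA sB] := sd x ABx.
  by have [/sA sdx|/sB sdx] := interior_subset ABx; exact: ex_diff.
(* The continuous extension of the partial derivative is glued from those of [f] and [g], which
   agree on the overlap. *)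
move=> e _; exists (fun x => if `[< A x >] then df x e else dg x e); split.
  apply: (glue (df ^~ e) (dg ^~ e)) => // x.
    by move=> Ax; rewrite asboolT.
  by move=> Bx; case: asboolP => // Ax; rewrite fg.
move=> x ABx; have [sA sB] := sd x ABx.
case: asboolP => [/sA sdx|nAx].
  by rewrite deriveE; [rewrite diff_val | exact: ex_diff].
have [//|/sB sdx] := interior_subset ABx.
by rewrite deriveE; [rewrite diff_val | exact: ex_diff].
Qed.

(** * Barycentric coordinates *)

Lemma ord3P (i : 'I_3) : [\/ i = ord0, i = inord 1 | i = inord 2].
Proof.
case: i => [[|[|[|//]]] lti]; [apply: Or31 | apply: Or32 | apply: Or33];
  by apply/val_inj; rewrite /= ?inordK.
Qed.

Lemma ordS3E :
  (ordS ord0 = inord 1 :> 'I_3) * (ordS (inord 1) = inord 2 :> 'I_3) *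
  (ordS (inord 2) = ord0 :> 'I_3).
Proof. by do !split; apply/val_inj; rewrite /= ?inordK. Qed.

Lemma ord_pred3E :
  (ord_pred ord0 = inord 2 :> 'I_3) * (ord_pred (inord 1) = ord0 :> 'I_3) *
  (ord_pred (inord 2) = inord 1 :> 'I_3).
Proof. by do !split; apply/val_inj; rewrite /= ?inordK. Qed.

Lemma big_ord3 (V : nmodType) (f : 'I_3 -> V) (i : 'I_3) :
  \sum_j f j = f i + f (ordS i) + f (ord_pred i).
Proof.
have -> : \sum_j f j = f ord0 + f (inord 1) + f (inord 2).
  rewrite !big_ord_recl big_ord0 addr0 addrA.
  by congr (_ + f _ + f _); apply/val_inj; rewrite /= inordK.
have [] := ord3P i => ->; rewrite !ordS3E !ord_pred3E //.
  by rewrite -addrA addrC.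
by rewrite addrC addrA.
Qed.

Definition affp (R : realType) (a b c : R) : mpoly 2 R[i] :=
  a%:C *: mpolyX _ (mnm1 ord0) + b%:C *: mpolyX _ (mnm1 ord_max) +
  mpolyC 2 c%:C.

Lemma peval_affp (R : realType) (a b c : R) (x : R * R) :
  peval (affp a b c) x = (a * x.1 + b * x.2 + c)%:C.
Proof.
by rewrite /peval /affp !mevalD !mevalZ !mevalXU mevalC !rmorphD !rmorphM.
Qed.

Section Barycentric.
Variables (R : realType) (T : triangle R).
Implicit Types (i : 'I_3) (x : R * R).

(** The barycentric coordinate of vertex [i], as a ratio of signed areas: the triangle on edge [i]
    with apex [x], over [T]. *)
Definition bary i x : R :=
  cross (edge_vec T i) (x - T (ordS i)) / orientation T.

Lemma orientationE i :
  orientation T = cross (edge_vec T i) (T i - T (ordS i)).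
Proof.
have [] := ord3P i => ->; rewrite /edge_vec !ordS3E !ord_pred3E;
  by rewrite /orientation /cross /=; ring.
Qed.

Lemma bary_affine i x y (t : R) :
  bary i (x + t *: (y - x)) = (1 - t) * bary i x + t * bary i y.
Proof. by rewrite /bary /cross /GRing.scale /= /GRing.scale /=; ring. Qed.

Lemma bary_edge_pt i t : bary i (edge_pt T i t) = 0.
Proof.
by rewrite /bary /edge_pt /cross /GRing.scale /= /GRing.scale /=; ring.
Qed.

Definition baryp i : mpoly 2 R[i] :=
  let e := edge_vec T i in let b := T (ordS i) in
  affp (- e.2 / orientation T) (e.1 / orientation T)
       ((e.2 * b.1 - e.1 * b.2) / orientation T).

Lemma peval_baryp i x : peval (baryp i) x = (bary i x)%:C.
Proof.
by rewrite peval_affp; congr (_%:C); rewrite /bary /cross /=; ring.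
Qed.

Hypothesis ndT : Defs.nondegenerate T.

(** Edge [i] ends at vertex [ord_pred i], so its parameter is the barycentric coordinate of that
    vertex. *)
Lemma bary_pred_edge_pt i t : bary (ord_pred i) (edge_pt T i t) = t.
Proof.
rewrite /bary; apply: (canLR (mulfK ndT)); rewrite (orientationE (ord_pred i)).
rewrite /edge_pt /edge_vec ord_predK.
have -> : ord_pred (ord_pred i) = ordS i.
  by have [] := ord3P i => ->; rewrite !ordS3E !ord_pred3E ?ordS3E.
rewrite /cross /GRing.scale /= /GRing.scale /=; ring.
Qed.

Lemma bary_sum x : \sum_i bary i x = 1.
Proof.
rewrite (big_ord3 _ ord0) -!mulrDl; apply: (canLR (mulfK ndT)); rewrite mul1r.
rewrite /edge_vec !ordS3E !ord_pred3E ?ordS3E /orientation /cross /=; ring.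
Qed.

Lemma bary_comb x : x = \sum_i bary i x *: T i.
Proof.
have combE (a b c : R) (u v w : R * R) : a *: u + b *: v + c *: w =
  (a * u.1 + b * v.1 + c * w.1, a * u.2 + b * v.2 + c * w.2) by [].
have ndT' : cross (T (inord 1) - T ord0) (T (inord 2) - T ord0) != 0 := ndT.
rewrite (big_ord3 _ ord0) combE /bary /edge_vec !ordS3E !ord_pred3E ?ordS3E.
rewrite /orientation; move: ndT'.
case: x (T ord0) (T (inord 1)) (T (inord 2)) => [x1 x2] [a1 a2] [b1 b2] [c1 c2].
by rewrite /cross /= => nz; congr pair; field.
Qed.

Lemma bary_vertices i (w : 'I_3 -> R) :
  \sum_j w j = 1 -> bary i (\sum_j w j *: T j) = w i.
Proof.
rewrite !(big_ord3 _ i) => w1; rewrite /bary; apply: (canLR (mulfK ndT)).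
have -> : w i = 1 - w (ordS i) - w (ord_pred i) by rewrite -w1; ring.
rewrite (orientationE i) /edge_vec /cross /GRing.scale /= /GRing.scale /=; ring.
Qed.

Lemma tri_setP x : tri_set T x <-> forall i, 0 <= bary i x.
Proof.
split=> [[w [w0 w1 ->]] i|x0]; first by rewrite bary_vertices.
by exists (bary^~ x); split => //; [exact: bary_sum | exact: bary_comb].
Qed.

Lemma bary_continuous i : continuous (bary i).
Proof.
move=> x; have -> : bary i = fun y => complex.Re (peval (baryp i) y).
  by apply/funext => y; rewrite peval_baryp.
have [Ld _] := is_diff_peval (baryp i) x.
exact/differentiable_continuous/(@ex_diff _ _ _ _ _ _ _ Ld).
Qed.

Lemma closed_tri_set : closed (tri_set T).
Proof.
have -> : tri_set T = \bigcap_(i in [set: 'I_3]) bary i @^-1` [set y | 0 <= y].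
  apply/seteqP; split=> x; first by move=> /tri_setP x0 i _; exact: x0.
  by move=> x0; apply/tri_setP => i; exact: x0.
apply: closed_bigI => i _; apply: preimage_closed; last exact: closed_ge.
by move=> x _; exact: bary_continuous.
Qed.

Lemma tri_set_interior x : (forall i, 0 < bary i x) -> (tri_set T)° x.
Proof.
move=> x0; have near_pos : \forall y \near x, forall i, 0 < bary i y.
  apply: (@filter_forall _ _ (fun i y => 0 < bary i y) (nbhs x)) => i.
  have : nbhs (bary i x) [set y | 0 < y].
    by apply: open_nbhs_nbhs; split; [exact: open_gt | exact: x0].
  exact: bary_continuous.
by apply: filterS near_pos => y y0; apply/tri_setP => i; exact: ltW.
Qed.

(** Moving from [x] towards the centroid makes every barycentric coordinate positive at once: it
    becomes (1 - t) times a nonnegative number plus t / 3. *)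
Lemma tri_set_closure_interior x : tri_set T x -> closure (tri_set T)° x.
Proof.
move=> /tri_setP x0 B Bx.
pose c := \sum_i (3^-1 : R) *: T i.
have bc i : bary i c = 3^-1.
  rewrite bary_vertices// sumr_const card_ord -[_ *+ 3]mulr_natr.
  by rewrite mulVf// pnatr_eq0.
have path_cvg : (fun t : R => x + t *: (c - x)) t @[t --> 0^'+] --> x.
  rewrite -[X in _ --> X]addr0 -(scale0r (c - x)).
  apply: cvg_at_right_filter.
  by apply: cvgD; [exact: cvg_cst | apply: cvgZr_tmp; exact: cvg_id].
have [t [t0 t1 Bt]] : exists t : R, [/\ 0 < t, t < 1 & B (x + t *: (c - x))].
  near (0 : R)^'+ => t; exists t; split => //.
  by near: t; apply: path_cvg.
exists (x + t *: (c - x)); split => //; apply: tri_set_interior => i.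
rewrite bary_affine bc ltr_wpDl// ?divr_gt0// mulr_ge0// subr_ge0 ltW//.
Unshelve. all: by end_near. Qed.

End Barycentric.

(** * Traces of glued polynomials *)

(** Continuity of [g] within [P] is enough, because the approximating points of [D] lie in [P]. *)
Lemma eq_on_closure (R : realType) (T : topologicalType) (P D : set T)
    (g h : T -> R) (z : T) :
  {within P, continuous g} -> continuous h -> D `<=` P -> P z ->
  closure D z -> (forall y, D y -> g y = h y) -> g z = h z.
Proof.
move=> /subspace_continuousP gc hc DP Pz Dz gh; apply: contrapT => /eqP gzhz.
pose e := `|g z - h z| / 2.
have e0 : 0 < e by rewrite divr_gt0// normr_gt0 subr_eq0.
have /cvgrPdist_lt/(_ e e0) := gc z Pz; rewrite near_withinE => gz.
have /cvgrPdist_lt/(_ e e0) hz := hc z.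
have [y [Dy [/(_ (DP y Dy)) gy hy]]] := Dz _ (filterI gz hz).
have : `|g z - h z| < e + e.
  rewrite -(subrKA (g y)) (le_lt_trans (ler_normD _ _))// ltrD//.
  by rewrite gh// distrC.
by rewrite /e -splitr ltxx.
Qed.

(** The same extension [h] equals the derivative of [f] inside [A] and that of [g] inside [B].
    Approaching [z] from either interior evaluates [h z] in two ways. *)
Lemma C1_real_derive_eq (R : realType) (A B : set (R * R))
    (f g s : R * R -> R) (df dg : R * R -> R * R -> R) (z e : R * R) :
  C1_real (A `|` B) s ->
  (forall x, A x -> s x = f x) -> (forall x, B x -> s x = g x) ->
  (forall x, is_diff x f (df x)) -> (forall x, is_diff x g (dg x)) ->
  (forall e, continuous (df ^~ e)) -> (forall e, continuous (dg ^~ e)) ->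
  A z -> B z -> closure A° z -> closure B° z -> e = (1, 0) \/ e = (0, 1) ->
  df z e = dg z e.
Proof.
move=> [_ _ sD] sf sg fd gd dfc dgc Az Bz cAz cBz /sD[h [hc hE]].
have key (C : set (R * R)) (u : R * R -> R) (du : R * R -> R * R -> R) :
    C `<=` A `|` B -> (forall x, C x -> s x = u x) ->
    (forall x, is_diff x u (du x)) -> continuous (du ^~ e) ->
    C z -> closure C° z -> h z = du z e.
  move=> CAB su ud duc Cz cCz.
  apply: (@eq_on_closure _ _ _ C° h (du ^~ e) z hc duc _ (CAB z Cz) cCz).
    by move=> y /interior_subset /CAB.
  move=> y Cy; rewrite -hE; last exact: (@interiorS _ C) Cy.
  have [udy uE] := ud y; rewrite -uE -deriveE//.
  (* Around an interior point of [C] the functions [s] and [u] coincide. *)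
  apply: near_eq_derive.
  by apply: filterS Cy => x /su.
transitivity (h z).
  by symmetry; apply: (key A f df) => // x; left.
by apply: (key B g dg) => // x; right.
Qed.

Lemma peval_continuous (R : realType) (q : mpoly 2 R[i]) :
  continuous (fun x : R * R => complex.Re (peval q x)) /\
  continuous (fun x : R * R => complex.Im (peval q x)).
Proof.
by split=> x; have [[rd _] [id _]] := is_diff_peval q x;
  exact: differentiable_continuous.
Qed.

Definition dpeval (R : realType) (q : mpoly 2 R[i]) (x e : R * R) : R[i] :=
  e.1%:C * peval (mderiv ord0 q) x + e.2%:C * peval (mderiv ord_max q) x.

Lemma dpeval_continuous (R : realType) (q : mpoly 2 R[i]) (e : R * R) :
  continuous (fun x : R * R => complex.Re (dpeval q x e)) /\
  continuous (fun x : R * R => complex.Im (dpeval q x e)).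
Proof.
have dqE x : dpeval q x e = peval
    (mpolyC 2 e.1%:C * mderiv ord0 q + mpolyC 2 e.2%:C * mderiv ord_max q) x.
  by rewrite pevalD 2!pevalM /peval 2!mevalC.
have [? ?] := peval_continuous
  (mpolyC 2 e.1%:C * mderiv ord0 q + mpolyC 2 e.2%:C * mderiv ord_max q).
by split; under eq_fun do rewrite dqE.
Qed.

Lemma complex_eqP (R : realType) (z w : R[i]) :
  complex.Re z = complex.Re w -> complex.Im z = complex.Im w -> z = w.
Proof. by case: z w => [? ?] [? ?] /= -> ->. Qed.

(** Density of the interiors serves the passage from C^1 to matching traces; closedness serves the
    gluing. *)
Lemma C1_complex_glueP (R : realType) (A B : set (R * R))
    (q1 q2 : mpoly 2 R[i]) :
  closed A -> closed B -> A `<=` closure A° -> B `<=` closure B° ->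
  (exists s, [/\ C1_complex (A `|` B) s, forall x, A x -> s x = peval q1 x &
                 forall x, B x -> s x = peval q2 x]) <->
  (forall x, A x -> B x -> peval q1 x = peval q2 x /\
     forall k, peval (mderiv k q1) x = peval (mderiv k q2) x).
Proof.
move=> cA cB iA iB.
have dr (q : mpoly 2 R[i]) x : is_diff x (fun y => complex.Re (peval q y))
    (fun e => complex.Re (dpeval q x e)) by have [] := is_diff_peval q x.
have di (q : mpoly 2 R[i]) x : is_diff x (fun y => complex.Im (peval q y))
    (fun e => complex.Im (dpeval q x e)) by have [] := is_diff_peval q x.
have cr (q : mpoly 2 R[i]) e := (dpeval_continuous q e).1.
have ci (q : mpoly 2 R[i]) e := (dpeval_continuous q e).2.
split=> [[s [[sr si] s1 s2]] x Ax Bx | q12].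
  split; first by rewrite -s1 ?s2.
  have dE e : e = (1, 0) \/ e = (0, 1) -> dpeval q1 x e = dpeval q2 x e.
    move=> eE; apply: complex_eqP.
      apply: (@C1_real_derive_eq _ A B _ _ _
        (fun x e => complex.Re (dpeval q1 x e))
        (fun x e => complex.Re (dpeval q2 x e)) x e sr _ _ (dr q1) (dr q2)
        (cr q1) (cr q2) Ax Bx (iA x Ax) (iB x Bx) eE).
        by move=> y /s1 ->.
      by move=> y /s2 ->.
    apply: (@C1_real_derive_eq _ A B _ _ _
      (fun x e => complex.Im (dpeval q1 x e))
      (fun x e => complex.Im (dpeval q2 x e)) x e si _ _ (di q1) (di q2)
      (ci q1) (ci q2) Ax Bx (iA x Ax) (iB x Bx) eE).
      by move=> y /s1 ->.
    by move=> y /s2 ->.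
  move=> k; have [->|->] : k = ord0 \/ k = ord_max.
  - by case: k => [[|[|//]] ?]; [left | right]; apply/val_inj.
  - have := dE (1, 0) (or_introl erefl).
    by rewrite /dpeval /= !mul0r !mul1r !addr0.
  - have := dE (0, 1) (or_intror erefl).
    by rewrite /dpeval /= !mul0r !mul1r !add0r.
pose s x := if `[< A x >] then peval q1 x else peval q2 x.
have s1 x : A x -> s x = peval q1 x by move=> Ax; rewrite /s asboolT.
have s2 x : B x -> s x = peval q2 x.
  by move=> Bx; rewrite /s; case: asboolP => // Ax; have [-> _] := q12 x Ax Bx.
have d12 x : A x -> B x -> dpeval q1 x = dpeval q2 x.
  move=> Ax Bx; apply/funext => e.
  by have [_ dE] := q12 x Ax Bx; rewrite /dpeval 2!dE.
exists s; split => //; split.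
  apply: (@C1_real_glue _ A B _ _ _ (fun x e => complex.Re (dpeval q1 x e))
      (fun x e => complex.Re (dpeval q2 x e)) cA cB _ _ (dr q1) (dr q2)
      (cr q1) (cr q2)).
  - by move=> x /s1 ->.
  - by move=> x /s2 ->.
  - by move=> x Ax Bx; rewrite d12.
apply: (@C1_real_glue _ A B _ _ _ (fun x e => complex.Im (dpeval q1 x e))
    (fun x e => complex.Im (dpeval q2 x e)) cA cB _ _ (di q1) (di q2)
    (ci q1) (ci q2)).
- by move=> x /s1 ->.
- by move=> x /s2 ->.
- by move=> x Ax Bx; rewrite d12.
Qed.

(** * Polynomials in edge coordinates *)

(** Phrased with degree bounds [a] and [b] so as to include the zero polynomial, whose [msize] is
    0. *)
Lemma msizeM_bound (n : nat) (F : idomainType) (p q : mpoly n F) (a b : nat) :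
  (msize p <= a.+1)%N -> (msize q <= b.+1)%N -> (msize (p * q) <= (a + b).+1)%N.
Proof.
have [->|p0] := eqVneq p 0; first by rewrite mul0r msize0.
have [->|q0] := eqVneq q 0; first by rewrite mulr0 msize0.
by rewrite msizeM// => ap bq; lia.
Qed.

Lemma msize_comp_affine (n k : nat) (F : idomainType)
    (lq : n.-tuple (mpoly k F)) (q : mpoly n F) (d : nat) :
  (forall j, (msize (tnth lq j) <= 2)%N) -> (msize q <= d)%N ->
  (msize (comp_mpoly lq q) <= d)%N.
Proof.
move=> lq2 qd; rewrite comp_mpolyE big_seq.
elim/big_ind: _ => [|x y xd yd|m mq]; first by rewrite msize0.
  by apply: leq_trans (msizeD_le _ _) _; rewrite geq_max xd.
apply: leq_trans (msizeZ_le _ _) _.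
apply: leq_trans _ qd; apply: leq_trans _ (msize_mdeg_lt mq).
rewrite mdegE; elim/big_ind2: _ => [|x a y b|j _]; first by rewrite msize1.
  exact: msizeM_bound.
elim: (m j) => [|e IH]; first by rewrite expr0 msize1.
by rewrite exprS; exact: (@msizeM_bound _ _ _ _ 1 e).
Qed.

Lemma mderiv_comp (n k : nat) (F : comNzRingType)
    (lq : n.-tuple (mpoly k F)) (q : mpoly n F) (i : 'I_k) :
  mderiv i (comp_mpoly lq q) =
  \sum_j comp_mpoly lq (mderiv j q) * mderiv i (tnth lq j).
Proof.
elim/mpoly_ring_ind: q => [a|j|p q IHp IHq|p q IHp IHq].
- rewrite comp_mpolyC mderivC big1// => j _.
  by rewrite mderivC comp_mpoly0 mul0r.
- rewrite comp_mpolyXU -tnth_nth (bigD1 j)//= big1 => [|l lj].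
    by rewrite mderivXU eqxx comp_mpoly1 mul1r addr0.
  by rewrite mderivXU eq_sym (negbTE lj) comp_mpoly0 mul0r.
- rewrite comp_mpolyD mderivD IHp IHq -big_split; apply: eq_bigr => j _ /=.
  by rewrite mderivD comp_mpolyD mulrDl.
rewrite rmorphM mderivM IHp IHq mulr_suml mulr_sumr -big_split.
apply: eq_bigr => j _ /=; rewrite mderivM comp_mpolyD !rmorphM/=.
by rewrite mulrDl; congr (_ + _); rewrite -?mulrA; congr (_ * _); rewrite mulrC.
Qed.

(** Substitution is a ring morphism, so checking the variables suffices. *)
Lemma comp_mpolyK (n : nat) (F : comNzRingType)
    (lp lq : n.-tuple (mpoly n F)) (q : mpoly n F) :
  (forall j, comp_mpoly lp (tnth lq j) = mpolyX F (mnm1 j)) ->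
  comp_mpoly lp (comp_mpoly lq q) = q.
Proof.
move=> lpq; elim/mpoly_ring_ind: q => [a|j|p q IHp IHq|p q IHp IHq].
- by rewrite !comp_mpolyC.
- by rewrite comp_mpolyXU -tnth_nth lpq.
- by rewrite !comp_mpolyD IHp IHq.
- by rewrite !rmorphM /= IHp IHq.
Qed.

Lemma monomials_free (n : nat) (F : nzRingType) (I : finType)
    (e : I -> multinom n) (x : I -> F) :
  injective e -> \sum_i x i *: mpolyX F (e i) = 0 -> forall i, x i = 0.
Proof.
move=> e_inj x0 i; have /(congr1 (mcoeff (e i))) := x0.
rewrite mcoeff0 raddf_sum/= (bigD1 i)//= big1 => [|j ji].
  by rewrite mcoeffZ mcoeffX eqxx mulr1 addr0.
by rewrite mcoeffZ mcoeffX (inj_eq e_inj) (negbTE ji) mulr0.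
Qed.

(** The point (t, 0): in edge coordinates the common edge lies on this axis. *)
Definition on_axis (F : nzRingType) (t : F) (k : 'I_2) : F :=
  if k == ord0 then t else 0.

Lemma mnm2P (m1 m2 : multinom 2) :
  m1 ord0 = m2 ord0 -> m1 ord_max = m2 ord_max -> m1 = m2.
Proof.
move=> e0 e1; apply/mnmP => -[[|[|//]] ltk].
  by rewrite (_ : Ordinal ltk = ord0) //; apply/val_inj.
by rewrite (_ : Ordinal ltk = ord_max) //; apply/val_inj.
Qed.

Lemma meval_on_axis_mpolyX (F : comNzRingType) (t : F) (m : multinom 2) :
  meval (on_axis t) (mpolyX F m) = (m ord_max == 0%N)%:R * t ^+ m ord0.
Proof.
rewrite mevalX big_ord_recl big_ord_recl big_ord0 mulr1 /on_axis /= mulrC.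
rewrite (_ : lift ord0 ord0 = ord_max); last exact/val_inj.
by rewrite expr0n.
Qed.

Lemma meval_on_axis_eq0 (F : comNzRingType) (t : F) (r : mpoly 2 F) :
  (forall m : multinom 2, m ord_max = 0%N -> mcoeff m r = 0) ->
  meval (on_axis t) r = 0.
Proof.
move=> r0; rewrite (mpolyE r) raddf_sum/= big1// => m _.
rewrite mevalZ meval_on_axis_mpolyX.
by have [/r0 ->|] := eqVneq (m ord_max) 0%N; rewrite !mul0r ?mulr0.
Qed.

(** The coefficients in question are those of the restriction of [r] to the axis, a univariate
    polynomial with infinitely many roots. *)
Lemma mcoeff_on_axis_eq0 (F : idomainType) (pts : nat -> F) (r : mpoly 2 F)
    (m : multinom 2) :
  injective pts -> (forall j, meval (on_axis (pts j)) r = 0) ->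
  m ord_max = 0%N -> mcoeff m r = 0.
Proof.
move=> pts_inj r0 m0.
have [|mr] := leqP (msize r) (mdeg m).
  by move=> /msize_mdeg_ge; rewrite -mcoeff_eq0 => /eqP.
pose u : {poly F} := \sum_(m : bmultinom 2 (msize r))
  (mcoeff m r * (m ord_max == 0%N)%:R) *: 'X^(m ord0).
have uE t : u.[t] = meval (on_axis t) r.
  rewrite [in RHS](mpolywE (leqnn (msize r))) raddf_sum horner_sum.
  apply: eq_bigr => l _; rewrite hornerZ hornerXn /= mevalZ.
  by rewrite meval_on_axis_mpolyX mulrA.
have u0 : u = 0.
  apply: contrapT => /eqP u_neq0.
  (* A nonzero [u] has fewer than [size u] roots, while [pts] supplies [size u] distinct ones. *)
  have := @max_poly_roots _ u (map pts (iota 0 (size u))) u_neq0.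
  rewrite size_map size_iota ltnn map_inj_uniq ?iota_uniq// => H.
  suff : false by [].
  by apply: H => //; apply/allP => _ /mapP[j _ ->]; rewrite /root uE r0.
have := congr1 (fun q : {poly F} => q`_(m ord0)) u0.
rewrite coef0 coef_sum (bigD1 (BMultinom mr))//= big1 => [|l lm].
  by rewrite coefZ coefXn m0 !eqxx !mulr1 addr0.
rewrite coefZ coefXn; case: (eqVneq (l ord_max) 0%N) => [l0|]; last first.
  by rewrite mulr0 mul0r.
case: eqP => [ml0|]; last by rewrite mulr0.
case/eqP: lm; apply/val_inj/mnm2P => /=; first by rewrite ml0.
by rewrite l0 m0.
Qed.

(** If the monomial [s] divides [r], the sum can be indexed by the exponents of the quotient, whose
    degree drops by [mdeg s]. *)
Lemma mpoly_sum_shift (n d : nat) (F : nzRingType) (r : mpoly n F)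
    (s : multinom n) :
  (msize r <= d + mdeg s)%N ->
  (forall m, ~~ lem s m -> mcoeff m r = 0) ->
  r = \sum_(m : bmultinom n d) mcoeff (mnm_add m s) r *:
      mpolyX F (mnm_add m s).
Proof.
move=> rd r0; apply/mpolyP => m; rewrite raddf_sum/=.
under eq_bigr => l _ do rewrite mcoeffZ mcoeffX.
have [sm|sm] := boolP (lem s m); last first.
  rewrite r0// big1// => l _; case: eqP => [lsm|]; last by rewrite mulr0.
  by rewrite -lsm lem_addl in sm.
have [ld|dl] := ltnP (mdeg (mnm_sub m s)) d.
  rewrite (bigD1 (BMultinom ld))//= submK// eqxx mulr1 big1 ?addr0// => l lm.
  case: eqP => [lsm|]; last by rewrite mulr0.
  by case/eqP: lm; apply/val_inj; rewrite /= -lsm addmK.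
have mr : mcoeff m r = 0.
  apply/eqP; rewrite mcoeff_eq0; apply: msize_mdeg_ge.
  by apply: leq_trans rd _; rewrite -(submK sm) mdegD leq_add2r.
rewrite mr big1// => l _; case: eqP => [lsm|]; last by rewrite mulr0.
by rewrite lsm mr mul0r.
Qed.

(** Each exponent is at most the total degree [d], so exponent vectors inject into tuples over
    ['I_d.+1], and the image consists of the tuples of sum at most [d]. *)
Lemma card_bmultinom (n d : nat) : #|{: bmultinom n d.+1}| = 'C(n + d, n).
Proof.
rewrite -card_partial_ord_partitions.
pose f (m : bmultinom n d.+1) : n.-tuple 'I_d.+1 := [tuple inord (m i) | i < n].
have md (m : bmultinom n d.+1) i : (m i < d.+1)%N.
  apply: leq_ltn_trans (bmdeg m); rewrite mdegE (bigD1 i)//=; exact: leq_addr.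
have f_inj : injective f.
  move=> m1 m2 m12; apply/val_inj/mnmP => i.
  have := congr1 (fun t => val (tnth t i)) m12.
  by rewrite /= !tnth_mktuple !inordK.
rewrite -(card_codom f_inj); apply: eq_card => t.
rewrite [RHS]inE; apply/codomP/idP => [[m ->]|td].
  rewrite big_tuple (eq_bigr (fun i => m i)) => [|i _]; last first.
    by rewrite tnth_mktuple inordK.
  by rewrite -ltnS -mdegE; exact: bmdeg.
have mP : (mdeg (Multinom (map_tuple val t)) < d.+1)%N.
  rewrite ltnS mdegE; move: td; rewrite big_tuple; congr (_ <= _)%N.
  by apply: eq_bigr => i _; rewrite /fun_of_multinom /= tnth_map.
exists (BMultinom mP); apply: eq_from_tnth => i; rewrite tnth_mktuple.
by apply: val_inj; rewrite /= inordK /fun_of_multinom /= tnth_map.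
Qed.

Lemma msizeZXU_le (n : nat) (F : comNzRingType) (a : F) (k : 'I_n) :
  (msize (a *: mpolyX F (mnm1 k)) <= 2)%N.
Proof. by apply: leq_trans (msizeZ_le _ _) _; rewrite msizeX mdeg1. Qed.

Lemma msize_affp (R : realType) (a b c : R) : (msize (affp a b c) <= 2)%N.
Proof.
apply: leq_trans (msizeD_le _ _) _; rewrite geq_max; apply/andP; split.
  apply: leq_trans (msizeD_le _ _) _; rewrite geq_max.
  by apply/andP; split; exact: msizeZXU_le.
by rewrite mmeasureC; case: (_ == _).
Qed.

Lemma mderiv_affp (R : realType) (a b c : R) (k : 'I_2) :
  mderiv k (affp a b c) = mpolyC 2 (if k == ord0 then a else b)%:C.
Proof.
rewrite /affp !mderivD !mderivZ !mderivXU mderivC addr0 -!mul_mpolyC.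
by case: k => [[|[|//]] ?] /=; rewrite mulr0 mulr1 ?addr0 ?add0r.
Qed.

Lemma affp_eq (R : realType) (a b c a' b' c' : R) :
  a = a' -> b = b' -> c = c' -> affp a b c = affp a' b' c'.
Proof. by move=> -> -> ->. Qed.

Lemma comp_affp (R : realType) (a b c a0 b0 c0 a1 b1 c1 : R) :
  comp_mpoly [tuple affp a0 b0 c0; affp a1 b1 c1] (affp a b c) =
  affp (a * a0 + b * a1) (a * b0 + b * b1) (a * c0 + b * c1 + c).
Proof.
rewrite /affp !comp_mpolyD !comp_mpolyZ !comp_mpolyXU comp_mpolyC /=.
rewrite -!mul_mpolyC !rmorphD !rmorphM /=.
move: (mpolyX _ _) (mpolyX _ _) => X Y; ring.
Qed.

Lemma affp_X (R : realType) (k : 'I_2) :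
  affp (k == ord0)%:R (k == ord_max)%:R 0 = mpolyX R[i] (mnm1 k).
Proof.
rewrite /affp -!mul_mpolyC !rmorph_nat rmorph0 addr0.
by case: k => [[|[|//]] ltk] /=; rewrite mul1r mul0r ?addr0 ?add0r;
  congr (mpolyX _ (mnm1 _)); apply/val_inj.
Qed.

Section EdgeCoordinates.
Variables (R : realType) (T : triangle R) (i : 'I_3).
Hypothesis ndT : Defs.nondegenerate T.

(* (t, l) in the notation of the header. *)
Definition edge_coords : 2.-tuple (mpoly 2 R[i]) :=
  [tuple baryp T (ord_pred i); baryp T i].

(** The two components of b + t (c - b) + l (a - b), the point with barycentric coordinates l at a
    and t at c. *)
Definition edge_coords_inv : 2.-tuple (mpoly 2 R[i]) :=
  let a := T i in let b := T (ordS i) in let c := T (ord_pred i) in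
  [tuple affp (c.1 - b.1) (a.1 - b.1) b.1; affp (c.2 - b.2) (a.2 - b.2) b.2].

(** Expressing everything through three vertices and one nonzero denominator turns both inversion
    identities into goals for [field]. *)
Lemma edge_coordsE :
  let a := T i in let b := T (ordS i) in let c := T (ord_pred i) in
  let e := b - a in let e' := c - b in let o := cross e' (a - b) in
  o != 0 /\
  edge_coords = [tuple
    affp (- e.2 / o) (e.1 / o) ((e.2 * a.1 - e.1 * a.2) / o);
    affp (- e'.2 / o) (e'.1 / o) ((e'.2 * b.1 - e'.1 * b.2) / o)].
Proof.
move=> a b c e e' o; have oE : orientation T = o := orientationE T i.
split; first by rewrite -oE; exact: ndT.
have -> : e = edge_vec T (ord_pred i).
  rewrite /e /edge_vec ord_predK; congr (T _ - _).
  by have [] := ord3P i => ->; rewrite !ordS3E !ord_pred3E ?ordS3E.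
by rewrite /edge_coords /baryp oE ord_predK.
Qed.

Lemma edge_coordsK :
  cancel (comp_mpoly edge_coords) (comp_mpoly edge_coords_inv).
Proof.
have [] := edge_coordsE; rewrite /edge_coords_inv.
move: (T i) (T (ordS i)) (T (ord_pred i)) => [a1 a2] [b1 b2] [c1 c2].
rewrite /cross /= => nz -> q; apply: comp_mpolyK => j; rewrite -affp_X.
case: j => [[|[|//]] ltj]; rewrite (tnth_nth 0) /= comp_affp;
  by apply: affp_eq => /=; field.
Qed.

Lemma edge_coords_invK :
  cancel (comp_mpoly edge_coords_inv) (comp_mpoly edge_coords).
Proof.
have [] := edge_coordsE; rewrite /edge_coords_inv.
move: (T i) (T (ordS i)) (T (ord_pred i)) => [a1 a2] [b1 b2] [c1 c2].
rewrite /cross /= => nz -> q; apply: comp_mpolyK => j; rewrite -affp_X.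
case: j => [[|[|//]] ltj]; rewrite (tnth_nth 0) /= comp_affp;
  by apply: affp_eq => /=; field.
Qed.

Lemma msize_edge_coords q d :
  (msize q <= d)%N -> (msize (comp_mpoly edge_coords q) <= d)%N.
Proof.
apply: msize_comp_affine => j; rewrite (tnth_nth 0).
by case: j => [[|[|//]] ?]; exact: msize_affp.
Qed.

Lemma msize_edge_coords_inv q d :
  (msize q <= d)%N -> (msize (comp_mpoly edge_coords_inv q) <= d)%N.
Proof.
apply: msize_comp_affine => j; rewrite (tnth_nth 0).
by case: j => [[|[|//]] ?]; exact: msize_affp.
Qed.

Lemma peval_edge_coords (q : mpoly 2 R[i]) t :
  peval (comp_mpoly edge_coords q) (edge_pt T i t) = meval (on_axis t%:C) q.
Proof.
rewrite /peval comp_mpoly_meval; apply: meval_eq => j; rewrite (tnth_nth 0).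
rewrite -/(peval _ _) /on_axis; case: j => [[|[|//]] ?] /=.
  by rewrite peval_baryp bary_pred_edge_pt.
by rewrite peval_baryp bary_edge_pt.
Qed.

(** The gradient of l is normal to the edge; if it vanished, the edge would have zero length and [T]
    would be degenerate. *)
Lemma mderiv_baryp_neq0 :
  exists (k : 'I_2) (a : R), a != 0 /\ mderiv k (baryp T i) = mpolyC 2 a%:C.
Proof.
have [e2|e2] := eqVneq (edge_vec T i).2 0; last first.
  exists ord0, (- (edge_vec T i).2 / orientation T); split.
    by rewrite mulf_neq0 ?invr_eq0 ?oppr_eq0.
  by rewrite mderiv_affp.
have [e1|e1] := eqVneq (edge_vec T i).1 0; last first.
  exists ord_max, ((edge_vec T i).1 / orientation T); split.
    by rewrite mulf_neq0 ?invr_eq0.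
  by rewrite mderiv_affp.
case/eqP: ndT.
by rewrite (orientationE T i) /cross e1 e2 !mul0r subrr.
Qed.

(** By the chain rule, the gradient of [q] combines the t- and l-derivatives of [r]. Vanishing of
    [q] on the edge removes the monomials free of l, and with them the t-derivative there; a nonzero
    component of the gradient of l then forces the l-derivative to vanish, which removes the
    monomials linear in l. *)
Lemma edge_vanishP (r : mpoly 2 R[i]) :
  let q := comp_mpoly edge_coords r in
  (forall t, 0 <= t <= 1 -> peval q (edge_pt T i t) = 0 /\
     forall k, peval (mderiv k q) (edge_pt T i t) = 0) <->
  (forall m : multinom 2, (m ord_max < 2)%N -> mcoeff m r = 0).
Proof.
move=> q.
have dq k t : peval (mderiv k q) (edge_pt T i t) =
    meval (on_axis t%:C) (mderiv ord0 r) *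
    peval (mderiv k (baryp T (ord_pred i))) (edge_pt T i t) +
    meval (on_axis t%:C) (mderiv ord_max r) *
    peval (mderiv k (baryp T i)) (edge_pt T i t).
  rewrite mderiv_comp big_ord_recl big_ord_recl big_ord0 addr0.
  rewrite (_ : lift ord0 ord0 = ord_max); last exact/val_inj.
  have ev (a b : mpoly 2 R[i]) : peval (comp_mpoly edge_coords a * b)
      (edge_pt T i t) =
      meval (on_axis t%:C) a * peval b (edge_pt T i t).
    by rewrite pevalM peval_edge_coords.
  by rewrite pevalD; congr (_ + _); exact: ev.
split=> [q0 | r0 t t01]; last first.
  have d0 j : meval (on_axis t%:C) (mderiv j r) = 0.
    apply: meval_on_axis_eq0 => m m0; rewrite mcoeff_mderiv r0 ?mul0rn//.
    by rewrite mnmDE m0 mnm1E; case: eqP.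
  split; first by rewrite peval_edge_coords; apply: meval_on_axis_eq0 => m m0;
    rewrite r0 ?m0.
  by move=> k; rewrite dq !d0 !mul0r addr0.
(* Infinitely many distinct parameters 1 / (j + 1) in the unit interval. *)
pose pts (j : nat) : R[i] := (j.+1%:R^-1)%:C.
have pts_inj : injective pts.
  move=> j l [] /invr_inj /eqP.
  by rewrite eqr_nat eqSS => /eqP.
have pts01 (j : nat) : 0 <= (j.+1%:R^-1 : R) <= 1.
  by rewrite invr_ge0 ler0n /= invf_le1 ?ltr0n// ler1n.
have r0 (m : multinom 2) : m ord_max = 0%N -> mcoeff m r = 0.
  apply: (mcoeff_on_axis_eq0 pts_inj) => j.
  by rewrite -peval_edge_coords; have [] := q0 _ (pts01 j).
have [k [a [a0 kL]]] := mderiv_baryp_neq0.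
have dr0 (m : multinom 2) : m ord_max = 0%N -> mcoeff m (mderiv ord_max r) = 0.
  apply: (mcoeff_on_axis_eq0 pts_inj) => j.
  have [_ /(_ k)/eqP] := q0 _ (pts01 j); rewrite dq kL.
  rewrite meval_on_axis_eq0 => [|l l0]; last first.
    by rewrite mcoeff_mderiv r0 ?mul0rn// mnmDE l0 mnm1E.
  rewrite mul0r add0r mulf_eq0 => /orP[/eqP //|].
  by rewrite /peval mevalC eq_complex /= (negbTE a0).
move=> m; case E : (m ord_max) => [|[|//]] _; first exact: r0.
have um : lem (mnm1 ord_max) m by rewrite lep1mP E.
(* Here l has exponent 1 in [m], so differentiating in l multiplies the coefficient by 1 only. *)
have := dr0 (mnm_sub m (mnm1 ord_max)).
rewrite mcoeff_mderiv submK// mnmBE mnm1E eqxx E subnn mulr1n.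
exact.
Qed.

End EdgeCoordinates.

(** * Dimensions of the two spaces *)

(** The edge coordinates of [K] serve for both pieces: the two triangles meet exactly along edge [i]
    of [K], so that is where the traces must match. *)
Lemma conforming_spaceP (R : realType) (K K' : triangle R) :
  macro_patch K K' -> exists2 i : 'I_3, Defs.nondegenerate K & forall p q,
    conforming_space K K' p q <->
    [/\ Pdeg p q.1, Pdeg p q.2 & forall m : multinom 2,
        (m ord_max < 2)%N ->
        mcoeff m (comp_mpoly (edge_coords_inv K i) (q.2 - q.1)) = 0].
Proof.
move=> [ndK ndK' _ [i [_ [_ KK']]]]; exists i => // p q.
have glueP := C1_complex_glueP q.1 q.2 (closed_tri_set ndK)
  (closed_tri_set ndK') (tri_set_closure_interior ndK)
  (tri_set_closure_interior ndK').
have := edge_vanishP i ndK (comp_mpoly (edge_coords_inv K i) (q.2 - q.1)).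
rewrite edge_coords_invK// => edgeP.
split=> [[q1p q2p /glueP agree] | [q1p q2p /edgeP vanish]].
  split=> //; apply/edgeP => t t01.
  have : (tri_set K `&` tri_set K') (edge_pt K i t).
    by rewrite KK'; exists t => //=; rewrite in_itv.
  move=> [Kt K't]; have [vE dE] := agree _ Kt K't.
  split; first by rewrite pevalB vE subrr.
  by move=> k; rewrite mderivB pevalB dE subrr.
split=> //; apply/glueP => x Kx K'x.
have : edge_set K i x by rewrite -KK'.
move=> [t /=]; rewrite in_itv/= => /vanish[vE dE] <-.
split; first by apply/esym/eqP; rewrite -subr_eq0 -pevalB vE.
by move=> k; apply/esym/eqP; rewrite -subr_eq0 -pevalB -mderivB dE.
Qed.

Lemma pieces_sum (R : realType) (I : finType) (x : I -> R[i])
    (b : I -> pieces R) :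
  \sum_i x i *: b i = (\sum_i x i *: (b i).1, \sum_i x i *: (b i).2).
Proof.
rewrite [LHS]surjective_pairing.
by congr pair; [rewrite (big_morph fst (fun _ _ => erefl) erefl) |
                rewrite (big_morph snd (fun _ _ => erefl) erefl)].
Qed.

Lemma comp_mpoly_sum (n k : nat) (F : comNzRingType) (I : finType)
    (lq : n.-tuple (mpoly k F)) (x : I -> F) (b : I -> mpoly n F) :
  \sum_i x i *: comp_mpoly lq (b i) = comp_mpoly lq (\sum_i x i *: b i).
Proof. by rewrite raddf_sum; apply: eq_bigr => i _; rewrite /= comp_mpolyZ. Qed.

Lemma bmultinom_val_inj (n d : nat) : injective (@bmnm n d).
Proof. exact: val_inj. Qed.

Lemma broken_space_card (R : realType) (d m : nat) (psi : 'I_m -> pieces R) :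
  is_basis (@broken_space R d) psi -> m = ('C(2 + d, 2) + 'C(2 + d, 2))%N.
Proof.
move=> psiB.
pose b (i : bmultinom 2 d.+1 + bmultinom 2 d.+1) : pieces R :=
  match i with
  | inl m => (mpolyX R[i] (bmnm m), 0)
  | inr m => (0, mpolyX R[i] (bmnm m))
  end.
have bE (x : bmultinom 2 d.+1 + bmultinom 2 d.+1 -> R[i]) : \sum_i x i *: b i =
    (\sum_m x (inl m) *: mpolyX R[i] (bmnm m),
     \sum_m x (inr m) *: mpolyX R[i] (bmnm m)).
  rewrite pieces_sum !big_sumType /=; congr pair.
    by rewrite [X in _ + X]big1 ?addr0// => j _; rewrite scaler0.
  by rewrite [X in X + _]big1 ?add0r// => j _; rewrite scaler0.
rewrite -!card_bmultinom -card_sum; apply: (is_basis_card psiB (b' := b)).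
- by move=> [l|l]; split; rewrite /Pdeg /= ?msize0 ?msizeX ?bmdeg.
- move=> x; rewrite bE => -[x1 x2] [l|l].
    by apply: (monomials_free (@bmultinom_val_inj _ _) x1).
  by apply: (monomials_free (@bmultinom_val_inj _ _) x2).
move=> [q1 q2] [q1d q2d].
exists (fun i => match i with
  | inl l => mcoeff (bmnm l) q1 | inr l => mcoeff (bmnm l) q2 end).
by rewrite bE -(mpolywE q1d) -(mpolywE q2d).
Qed.

(** The degree p is [d.+2]. The basis has a diagonal part, one pair per monomial of degree at most
    p, and a part supported on [K'], one pair per monomial of degree at most p - 2 multiplied by
    l^2. *)
Lemma conforming_space_card (R : realType) (K K' : triangle R) (d n : nat)
    (v : 'I_n -> pieces R) :
  macro_patch K K' -> is_basis (conforming_space K K' d.+2) v ->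
  n = ('C(2 + d.+2, 2) + 'C(2 + d, 2))%N.
Proof.
move=> /conforming_spaceP[i ndK confP] vB.
set phi := comp_mpoly (edge_coords K i).
set psi := comp_mpoly (edge_coords_inv K i).
have phiK : cancel phi psi := edge_coordsK i ndK.
have psiK : cancel psi phi := edge_coords_invK i ndK.
have phi_inj : injective phi := can_inj phiK.
have phi0 : phi 0 = 0 := comp_mpoly0 _.
(* The exponent of l^2. *)
pose s : multinom 2 := mnm_muln (mnm1 ord_max) 2.
pose sh (m : bmultinom 2 d.+1) := mnm_add m s.
have sh_inj : injective sh by move=> m1 m2 /addIm /val_inj.
pose b (j : bmultinom 2 d.+3 + bmultinom 2 d.+1) : pieces R :=
  match j with
  | inl m => (phi (mpolyX R[i] (bmnm m)), phi (mpolyX R[i] (bmnm m)))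
  | inr m => (0, phi (mpolyX R[i] (sh m)))
  end.
have bE (x : bmultinom 2 d.+3 + bmultinom 2 d.+1 -> R[i]) : \sum_i x i *: b i =
    (phi (\sum_m x (inl m) *: mpolyX R[i] (bmnm m)),
     phi (\sum_m x (inl m) *: mpolyX R[i] (bmnm m)) +
     phi (\sum_m x (inr m) *: mpolyX R[i] (sh m))).
  rewrite pieces_sum !big_sumType /=; congr pair; last first.
    by congr (_ + _); exact: comp_mpoly_sum.
  rewrite [X in _ + X]big1 ?addr0 => [|j _]; last by rewrite scaler0.
  exact: comp_mpoly_sum.
rewrite -!card_bmultinom -card_sum; apply: (is_basis_card vB (b' := b)).
- move=> [l|l]; apply/confP; split=> /=.
  + by apply: msize_edge_coords; rewrite msizeX bmdeg.
  + by apply: msize_edge_coords; rewrite msizeX bmdeg.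
  + by move=> m _; rewrite subrr comp_mpoly0 mcoeff0.
  + by rewrite /Pdeg /= msize0.
  + apply: msize_edge_coords; rewrite msizeX mdegD mdegMn mdeg1 mul1n.
    by rewrite addn2 !ltnS -ltnS; exact: bmdeg.
  move=> m m2; rewrite subr0 -/psi phiK mcoeffX; case: eqP => // shm.
  by move: m2; rewrite -shm mnmDE mulmnE mnm1E eqxx mul1n addn2.
- move=> x; rewrite bE => x0.
  have x1 : phi (\sum_m x (inl m) *: mpolyX R[i] (bmnm m)) = 0 :=
    congr1 fst x0.
  have x2 : phi (\sum_m x (inl m) *: mpolyX R[i] (bmnm m)) +
      phi (\sum_m x (inr m) *: mpolyX R[i] (sh m)) = 0 := congr1 snd x0.
  have y1 : \sum_m x (inl m) *: mpolyX R[i] (bmnm m) = 0.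
    by apply: phi_inj; rewrite x1 phi0.
  rewrite y1 phi0 add0r in x2; move=> [l|l].
    by apply: (monomials_free (@bmultinom_val_inj _ _) y1).
  apply: (@monomials_free _ _ _ sh (fun l => x (inr l)) sh_inj).
  by apply: phi_inj; rewrite x2 phi0.
move=> [q1 q2] /confP[/= q1d q2d q0].
exists (fun j => match j with
  | inl l => mcoeff (bmnm l) (psi q1)
  | inr l => mcoeff (sh l) (psi (q2 - q1)) end).
rewrite bE -(mpolywE (@msize_edge_coords_inv _ K i _ _ q1d)) psiK.
rewrite -(@mpoly_sum_shift _ _ _ (psi (q2 - q1)) s) ?psiK; first 1 last.
- rewrite mdegMn mdeg1 mul1n addn2; apply: msize_edge_coords_inv.
  apply: leq_trans (msizeD_le _ _) _; rewrite geq_max; apply/andP; split => //.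
  by rewrite mmeasureN.
- move=> m sm; apply: q0; rewrite ltnNge; apply: contra sm => m2.
  apply/mnm_lepP => k; rewrite mulmnE mnm1E; case: eqP => [<-|//].
  by rewrite mul1n.
by rewrite addrC subrK.
Qed.

Theorem proposition3p6 (R : realType) (K K' : triangle R) (p : nat) (kappa : R)
    (c : coefficients R * coefficients R) (n m : nat)
    (v : 'I_n -> pieces R) (psi : 'I_m -> pieces R)
    (hP : macro_patch K K') (hp : (2 <= p)%N) (hkappa : 0 < kappa)
    (hv : is_basis (conforming_space K K' p) v)
    (hpsi : is_basis (@broken_space R (p - 2)) psi)
    (hrank : \rank (residual_matrix kappa K K' c v psi) = m) :
  dimker (residual_matrix kappa K K' c v psi) = (2 * p + 1)%N /\
  exists eps : R, 0 < eps /\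
    forall c' : coefficients R * coefficients R,
      mxnorm2 (residual_matrix kappa K K' c' v psi -
               residual_matrix kappa K K' c v psi) < eps ->
      dimker (residual_matrix kappa K K' c' v psi) = (2 * p + 1)%N.
Proof.
(* With p = d + 2, one summand C(d+2, 2) cancels, leaving C(d+4, 2) - C(d+2, 2) = 2d + 5. *)
have nm : (n - m)%N = (2 * p + 1)%N.
  case: p hp hv hpsi => [|[|d]]// _ hv hpsi.
  rewrite (broken_space_card hpsi) (conforming_space_card hP hv) subn2 /=.
  by rewrite subnDr !bin2 /=; nia.
split; first by rewrite dimker_full_rank.
(* The sizes [n] and [m] come from the fixed bases, so full rank of the perturbed matrix gives the
   same difference. *)
have [eps eps0 stable] := full_rank_stable hrank.
by exists eps; split => // c' /stable rank'; rewrite dimker_full_rank.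
Qed.
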